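(* Let $P$ be a polygon with a dissection $D$, and let $K$ be a semifield. A map $f : \operatorname{diag}(P) \to K$ is a weak frieze with respect to $D$ if and only if it satisfies the $T$-path formula with respect to $D$, i.e. if and only if for all vertices $\alpha \neq \beta$ of $P$, \[ f(\alpha,\beta) = \sum_{\pi \in \mathcal{T}_{P,D}(\alpha,\beta)} f(\pi). \]
   Context: A semifield is a set $K$ with binary operations $+$ and $\cdot$ such that $+$ is associative and commutative, $(K,\cdot)$ is a commutative group (unit $1_K$, inverse $x^{-1}$), and $\cdot$ distributes over $+$; no additive identity or subtraction is assumed. Write $x/y := xy^{-1}$. A polygon $P$ is a finite set $V$ of at least three vertices equipped with a cyclic order; we picture it as a convex polygon in the Euclidean plane whose vertices appear anticlockwise in this cyclic order. A diagonal of $P$ is a two-element subset $\{\alpha,\beta\}$ of $V$ (so edges $\{\alpha,\alpha^+\}$, with $\alpha^+$ the successor of $\alpha$, count as diagonals); $\operatorname{diag}(P)$ is the set of diagonals. Diagonals that are not edges are internal. Diagonals $\{\alpha,\beta\}$ and $\{\gamma,\delta\}$ cross if $\alpha,\beta,\gamma,\delta$ are four distinct vertices appearing in the cyclic order as $\alpha,\gamma,\beta,\delta$ or $\alpha,\delta,\beta,\gamma$. A dissection of $P$ is a (possibly empty) set of pairwise non-crossing internal diagonals. For $f:\operatorname{diag}(P)\to K$ write $f(\alpha,\beta):=f(\{\alpha,\beta\})$. $f$ is a weak frieze with respect to a dissection $D$ if $f(\alpha,\beta)f(\gamma,\delta) = f(\alpha,\gamma)f(\beta,\delta) + f(\alpha,\delta)f(\beta,\gamma)$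 (the Ptolemy relation) whenever $\{\alpha,\beta\}$ and $\{\gamma,\delta\}$ are crossing diagonals with $\{\gamma,\delta\} \in D$. For vertices $\pi_1 \neq \pi_p$, a $T$-path from $\pi_1$ to $\pi_p$ with respect to $D$ is an ordered tuple $\pi=(\pi_1,\dots,\pi_p)$ of vertices such that: (i) $\{\pi_1,\pi_2\},\dots,\{\pi_{p-1},\pi_p\}$ are pairwise different diagonals; (ii) no $\{\pi_i,\pi_{i+1}\}$ crosses a diagonal in $D$; (iii) every diagonal $\{\pi_{2j},\pi_{2j+1}\}$ lies in $D$, and these diagonals cross the segment $\{\pi_1,\pi_p\}$ (in the convex realization) at pairwise different points which progress monotonically in the direction from $\pi_1$ to $\pi_p$. $\mathcal{T}_{P,D}(\alpha,\beta)$ denotes the set of $T$-paths from $\alpha$ to $\beta$ with respect to $D$. For a $T$-path $\pi$, $f(\pi) := \prod_{i \text{ odd}} f(\pi_i,\pi_{i+1}) \big/ \prod_{j \text{ even}} f(\pi_j,\pi_{j+1})$ (indices $1\le i,j\le p-1$). *)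

(* Defs.v *)
From HB Require Import structures.
From mathcomp Require Import all_boot all_order all_algebra.
Set Implicit Arguments. Unset Strict Implicit. Unset Printing Implicit Defensive.
Import Order.TTheory GRing.Theory Num.Theory.

Record semifield := Semifield {
  sf_car :> Type;
  sf_add : sf_car -> sf_car -> sf_car;
  sf_mul : sf_car -> sf_car -> sf_car;
  sf_one : sf_car;
  sf_inv : sf_car -> sf_car;
  sf_addA : forall x y z, sf_add x (sf_add y z) = sf_add (sf_add x y) z;
  sf_addC : forall x y, sf_add x y = sf_add y x;
  sf_mulA : forall x y z, sf_mul x (sf_mul y z) = sf_mul (sf_mul x y) z;
  sf_mulC : forall x y, sf_mul x y = sf_mul y x;
  sf_mul1 : forall x, sf_mul sf_one x = x;
  sf_mulV : forall x, sf_mul (sf_inv x) x = sf_one;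
  sf_mulDl : forall x y z,
      sf_mul (sf_add x y) z = sf_add (sf_mul x z) (sf_mul y z)
}.

Section Semifield.
Variable K : semifield.

Definition sf_prod (s : seq K) : K := foldr (@sf_mul K) (@sf_one K) s.

(* sum of a list; undefined (None) for the empty list since K has no zero *)
Definition sf_sum (s : seq K) : option K :=
  match s with
  | [::] => None
  | x :: s' => Some (foldr (@sf_add K) x s')
  end.
End Semifield.

(* The polygon: vertex set 'I_n (n >= 3) with the cyclic order            *)
(* 0 -> 1 -> ... -> n-1 -> 0.  Diagonals are 2-element subsets.            *)
Section Polygon.
Variable n : nat.

Definition diag_of (a b : 'I_n) : {set 'I_n} := [set a; b].

Definition cyc4 (a b c d : 'I_n) : bool :=
  [|| [&& a < b, b < c & c < d], [&& b < c, c < d & d < a],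
      [&& c < d, d < a & a < b] | [&& d < a, a < b & b < c]]%N.

(* crossing diagonals: X = {a,b}, Y = {c,d}, in cyclic order a,c,b,d
   (the order a,d,b,c is covered by renaming c <-> d) *)
Definition cross (X Y : {set 'I_n}) : bool :=
  [exists a : 'I_n, exists b : 'I_n, exists c : 'I_n, exists d : 'I_n,
     [&& X == [set a; b], Y == [set c; d] & cyc4 a c b d]].

Definition is_edge (X : {set 'I_n}) : bool :=
  [exists a : 'I_n, exists b : 'I_n,
     (X == [set a; b]) && (b == (a.+1 %% n) :> nat)].

Definition is_diag (X : {set 'I_n}) : bool := #|X| == 2.

Definition internal (X : {set 'I_n}) : bool := is_diag X && ~~ is_edge X.

Definition dissection (D : {set {set 'I_n}}) : Prop :=
  (forall X, X \in D -> internal X) /\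
  (forall X Y, X \in D -> Y \in D -> ~~ cross X Y).

Variable K : semifield.

Definition weak_frieze (D : {set {set 'I_n}}) (f : {set 'I_n} -> K) : Prop :=
  forall a b c d : 'I_n, [set c; d] \in D -> cross [set a; b] [set c; d] ->
    sf_mul (f [set a; b]) (f [set c; d]) =
    sf_add (sf_mul (f [set a; c]) (f [set b; d]))
           (sf_mul (f [set a; d]) (f [set b; c])).

(* A convex realization of the polygon: vertex k at (k, k^2) on the parabola
   (anticlockwise in the order 0, 1, ..., n-1). *)
Definition ptx (k : 'I_n) : rat := (k%:R)%R.
Definition pty (k : 'I_n) : rat := ((k%:R) ^+ 2)%R.
Definition cross2 (x1 y1 x2 y2 : rat) : rat := (x1 * y2 - y1 * x2)%R.

(* Parameter t such that the line through a,b meets the segment from p to q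
   at p + t (q - p); used to order crossing points along that segment. *)
Definition tpos (p q a b : 'I_n) : rat :=
  (cross2 (ptx a - ptx p) (pty a - pty p) (ptx b - ptx a) (pty b - pty a) /
   cross2 (ptx q - ptx p) (pty q - pty p) (ptx b - ptx a) (pty b - pty a))%R.

Definition steps (pi : seq 'I_n) : seq ('I_n * 'I_n) := zip pi (behead pi).

(* steps with even 0-based index = odd 1-based index i; and the others *)
Definition odd_steps (pi : seq 'I_n) :=
  [seq st.2 | st <- zip (iota 0 (size (steps pi))) (steps pi) & ~~ odd st.1].
Definition even_steps (pi : seq 'I_n) :=
  [seq st.2 | st <- zip (iota 0 (size (steps pi))) (steps pi) & odd st.1].

Definition is_Tpath (D : {set {set 'I_n}}) (alpha beta : 'I_n)
    (pi : seq 'I_n) : bool :=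
  [&& (1 < size pi)%N, head alpha pi == alpha, last alpha pi == beta,
      alpha != beta,
      all (fun st => st.1 != st.2) (steps pi),
      uniq [seq [set st.1; st.2] | st <- steps pi],
      all (fun st => [forall X in D, ~~ cross [set st.1; st.2] X]) (steps pi),
      all (fun st => ([set st.1; st.2] \in D) &&
                     cross [set st.1; st.2] [set alpha; beta]) (even_steps pi)
    &
      sorted (fun x y : rat => (x < y)%R)
             [seq tpos alpha beta st.1 st.2 | st <- even_steps pi]].

Definition Tweight (f : {set 'I_n} -> K) (pi : seq 'I_n) : K :=
  sf_mul (sf_prod [seq f [set st.1; st.2] | st <- odd_steps pi])
         (sf_inv (sf_prod [seq f [set st.1; st.2] | st <- even_steps pi])).

Definition Tpath_formula (D : {set {set 'I_n}}) (f : {set 'I_n} -> K) : Prop :=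
  forall alpha beta : 'I_n, alpha != beta ->
    exists s : seq (seq 'I_n),
      [/\ uniq s, (forall pi, (pi \in s) = is_Tpath D alpha beta pi)
        & sf_sum [seq Tweight f pi | pi <- s] = Some (f [set alpha; beta])].

End Polygon.

(* Main.v *)
(** Fix a target vertex b and use the coordinate "number of anticlockwise steps
    from b".  The diagonals of D crossing {a, b} then become intervals around the
    coordinate of a; they are nested because D is non-crossing, and along the
    segment from a to b they are met in order of increasing length.  If {g, d} is
    the first one met from a, prolonging backwards to a (replacing an initial
    g, d by a, d, and otherwise prepending a, d) maps the T-paths from g to b
    bijectively onto the T-paths from a to b with second vertex d, and multiplies
    weights by f(a,d)/f(g,d); likewise with g and d exchanged.  So the T-path sums
    satisfy the Ptolemy relation for the first crossed diagonal, and induction on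
    the number of diagonals of D crossing {a, b} gives the T-path formula for weak
    friezes.  Conversely, the Ptolemy relation for an arbitrary diagonal of D
    follows from that for the first one by the same induction. *)
Require Import Defs.
From mathcomp Require Import all_boot all_order all_algebra.
From mathcomp Require Import zify ring.
Set Implicit Arguments. Unset Strict Implicit. Unset Printing Implicit Defensive.
Import Order.TTheory GRing.Theory Num.Theory.

(** * Coordinates and crossing points *)

Section Coordinates.
Variable n : nat.
Implicit Types a b c d u v : 'I_n.

(* [co b v = (v - b) mod n] *)
Definition co b v : nat := if b <= v then v - b else v + n - b.

Lemma co_inj b : injective (co b).
Proof.
move=> u v; rewrite /co => e; apply: val_inj => /=; move: e.
have := ltn_ord u; have := ltn_ord v; have := ltn_ord b.
by case: ifP; case: ifP; lia.
Qed.

Lemma co0 b : co b b = 0.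
Proof. by rewrite /co leqnn subnn. Qed.

Lemma set2_eq a b c d :
  [set a; b] = [set c; d] -> (a = c /\ b = d) \/ (a = d /\ b = c).
Proof.
move=> e.
have : a \in [set c; d] by rewrite -e !inE eqxx.
have : b \in [set c; d] by rewrite -e !inE eqxx orbT.
have : c \in [set a; b] by rewrite e !inE eqxx.
have : d \in [set a; b] by rewrite e !inE eqxx orbT.
by rewrite !inE => /orP[]/eqP h1 /orP[]/eqP h2 /orP[]/eqP h3 /orP[]/eqP h4;
   subst; tauto.
Qed.

(** [cyc4] on arbitrary naturals, so that coordinates from any base vertex can be inserted. *)
Definition cycn (a b c d : nat) : bool :=
  [|| [&& a < b, b < c & c < d], [&& b < c, c < d & d < a],
      [&& c < d, d < a & a < b] | [&& d < a, a < b & b < c]].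

Lemma cycn_rot2 x y z t : cycn x y z t = cycn z t x y.
Proof. by rewrite /cycn; case: (x < y); case: (y < z); case: (z < t); case: (t < x). Qed.

(** A two-element set fixes its endpoints up to exchange, and [cyc4] is invariant under rotation by
    two places, so only two orders remain. *)
Lemma cross_cyc4 a b c d :
  cross [set a; b] [set c; d] = cyc4 a c b d || cyc4 a d b c.
Proof.
have E (x y z t : 'I_n) : cyc4 x y z t = cyc4 z t x y := cycn_rot2 x y z t.
apply/existsP/idP.
  move=> [a' /existsP[b' /existsP[c' /existsP[d' /and3P[/eqP e /eqP e' h]]]]].
  case: (set2_eq e) => -[-> ->]; case: (set2_eq e') => -[-> ->];
    by [rewrite h ?orbT | move: h; rewrite E => ->; rewrite ?orbT].
case/orP => h.
  by exists a; apply/existsP; exists b; apply/existsP; exists c;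
     apply/existsP; exists d; rewrite !eqxx.
by exists a; apply/existsP; exists b; apply/existsP; exists d;
   apply/existsP; exists c; rewrite eqxx [[set d; c]]setUC eqxx.
Qed.

Lemma co_lt p v w : (co p v < co p w) =
  if p <= v then if p <= w then v < w else true
  else if p <= w then false else v < w.
Proof.
rewrite /co; have := ltn_ord v; have := ltn_ord w; have := ltn_ord p.
case: (leqP p v) => ?; case: (leqP p w) => ? ? ? ?.
- by lia.
- by apply/idP; lia.
- by apply/negP; lia.
- by lia.
Qed.

(** Coordinates move the vertices before p behind the others and keep the order within both blocks:
    a rotation, which preserves cyclic order. *)
Lemma cyc4_co p a b c d :
  cyc4 a b c d = cycn (co p a) (co p b) (co p c) (co p d).
Proof.
rewrite /cycn !(co_lt p) /cyc4.
have F (v w : 'I_n) : p <= v -> ~~ (p <= w) -> (w < v) /\ ((v < w) = false).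
  by rewrite -ltnNge => h h'; split; [lia | apply/negP; lia].
case Ea: (p <= a); case Eb: (p <= b); case Ec: (p <= c); case Ed: (p <= d) => //;
repeat match goal with
 | H : (nat_of_ord p <= nat_of_ord ?v) = true,
   H' : (nat_of_ord p <= nat_of_ord ?w) = false
   |- context [nat_of_ord ?v < nat_of_ord ?w] =>
     rewrite (F v w H (negbT H')).2
 | H : (nat_of_ord p <= nat_of_ord ?v) = true,
   H' : (nat_of_ord p <= nat_of_ord ?w) = false
   |- context [nat_of_ord ?w < nat_of_ord ?v] =>
     rewrite (F v w H (negbT H')).1
 end; rewrite ?andbT ?andbF ?orbT ?orbF //=;
 by rewrite ?andbA ?orbA; do ?[case: (_ < _) => //=].
Qed.

Lemma cross_cycn p a b c d : cross [set a; b] [set c; d] =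
  cycn (co p a) (co p c) (co p b) (co p d) ||
  cycn (co p a) (co p d) (co p b) (co p c).
Proof. by rewrite cross_cyc4 !(cyc4_co p). Qed.

Lemma crossC a b c d : cross [set a; b] [set c; d] = cross [set c; d] [set a; b].
Proof.
rewrite !cross_cyc4 orbC; congr (_ || _).
  by rewrite /cyc4; do ![case: (_ < _) => //=].
by rewrite /cyc4; do ![case: (_ < _) => //=].
Qed.

Lemma cross_lt p a b c d : co p a < co p c -> co p c < co p b ->
  co p b < co p d -> cross [set a; b] [set c; d].
Proof. by move=> h1 h2 h3; rewrite (cross_cycn p) /cycn h1 h2 h3. Qed.

(** Crossing with {a, b}, seen from b at coordinate 0: positivity excludes b as an endpoint. *)
Definition around b a u v :=
  [&& 0 < co b u, co b u < co b a & co b a < co b v] ||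
  [&& 0 < co b v, co b v < co b a & co b a < co b u].
(** Subtraction is truncated, so one summand vanishes and this is an absolute difference. *)
Definition len b u v := (co b u - co b v) + (co b v - co b u).

Lemma cross_around a b u v : cross [set u; v] [set a; b] = around b a u v.
Proof.
by rewrite (cross_cycn b) co0 /cycn /around !ltn0 ?andbF ?andbT ?orbF /=.
Qed.

(** * Order of the crossing points along a chord of the parabola *)

Local Open Scope ring_scope.

(** The chord of the parabola through x and y has slope x + y, so y - x cancels from numerator and
    denominator. *)
Lemma tposE p q u v : u != v -> p != q ->
  tpos p q u v = ((u%:R - p%:R) * (v%:R - p%:R)) /
    ((q%:R - p%:R) * (u%:R + v%:R - p%:R - q%:R)).
Proof.
move=> huv hpq; rewrite /tpos /cross2 /ptx /pty.
set x := (u%:R); set y := (v%:R); set a := (p%:R); set b := (q%:R).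
have e : y - x != 0 by rewrite subr_eq0 eqr_nat eq_sym.
rewrite [X in _ / X](_ : _ = (y - x) * ((b - a) * (x + y - a - b))); last by ring.
rewrite [X in X / _](_ : _ = (y - x) * ((x - a) * (y - a))); last by ring.
by rewrite -mulf_div divff // mul1r.
Qed.

Lemma tpos_sym p q u v : u != v -> p != q -> tpos p q u v = tpos p q v u.
Proof.
move=> h h'; rewrite !tposE // 1?eq_sym //; congr (_ / _); first by rewrite mulrC.
by rewrite [u%:R + _]addrC.
Qed.

Lemma sgr_natB (i j : nat) : Num.sg (i%:R - j%:R : rat) =
  if (i < j)%N then -1 else if (j < i)%N then 1 else 0.
Proof.
case: ltngtP => h; last by rewrite h subrr sgr0.
  by apply: ltr0_sg; rewrite subr_lt0 ltr_nat.
by apply: gtr0_sg; rewrite subr_gt0 ltr_nat.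
Qed.

(* With N and M the numerator and denominator in [tposE], M = N - (x - b)(y - b);
   so opposite signs of N and (x - b)(y - b) force M to have the sign of N. *)
Lemma tpos_den_gt0 (x y a b : rat) :
  (x - a) * (y - a) * ((x - b) * (y - b)) < 0 ->
  0 < (x - a) * (y - a) * ((b - a) * (x + y - a - b)).
Proof.
set N := (x - a) * (y - a); set N' := (x - b) * (y - b) => h.
have -> : (b - a) * (x + y - a - b) = N - N' by rewrite /N /N'; ring.
rewrite mulrBr subr_gt0; apply: lt_le_trans h _.
by rewrite -expr2 sqr_ge0.
Qed.

(* Each vertex occurs an even number of times, so the sign of this product does
   not depend on where the cyclic order is cut. *)
Lemma cross_ratio_lt0 p q u u' v :
  [&& 0 < co q u', co q u' < co q u, co q u < co q p & co q p < co q v]%N ||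
  [&& 0 < co q v, co q v < co q p, co q p < co q u & co q u < co q u']%N ->
  ((q%:R - p%:R) * (v%:R - p%:R) * (v%:R - q%:R) * (u%:R - u'%:R)
    * (u%:R - p%:R) * (u'%:R - p%:R) : rat) < 0.
Proof.
move=> h; rewrite -sgr_cp0 !sgrM !sgr_natB; move: h; rewrite /co.
have := ltn_ord u; have := ltn_ord v; have := ltn_ord p; have := ltn_ord u'.
have := ltn_ord q.
case: (leqP q u) => ?; case: (leqP q u') => ?;
case: (leqP q v) => ?; case: (leqP q p) => ? ? ? ? ? ? /orP[]/and4P[? ? ? ?].
all: try by exfalso; lia.
all: repeat match goal with |- context [if (?i < ?j)%N then _ else _] =>
  first [ have -> : (i < j)%N = true by lia
        | have -> : (i < j)%N = false by apply/negP; lia ] end.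
all: by rewrite ?mulrNN ?mulr1 ?mul1r ?mulrN1 ?opprK.
Qed.

(** As {u, v} and {p, q} interleave, an odd number of the four differences in [tpos_den_gt0] is
    negative. *)
Lemma tpos_den_around p q u v : around q p u v ->
  0 < (u%:R - p%:R : rat) * (v%:R - p%:R) *
      ((q%:R - p%:R) * (u%:R + v%:R - p%:R - q%:R)).
Proof.
move=> h; apply: tpos_den_gt0.
rewrite -sgr_cp0 !sgrM !sgr_natB; move: h; rewrite /around /co.
have := ltn_ord u; have := ltn_ord v; have := ltn_ord p; have := ltn_ord q.
case: (leqP q u) => ?; case: (leqP q v) => ?;
case: (leqP q p) => ? ? ? ? ? /orP[]/and3P[? ? ?].
all: try by exfalso; lia.
all: repeat match goal with |- context [if (?i < ?j)%N then _ else _] =>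
  first [ have -> : (i < j)%N = true by lia
        | have -> : (i < j)%N = false by apply/negP; lia ] end.
all: by rewrite ?mulrNN ?mulr1 ?mul1r ?mulrN1 ?opprK.
Qed.

(* tpos(u,v) - tpos(u',v) = (q-p)(v-p)(v-q)(u-u') / (M M'), and the denominators
   M, M' have the signs of (u-p)(v-p) and (u'-p)(v-p). *)
Lemma tpos_mono p q u u' v : around q p u v -> around q p u' v ->
  (len q u v < len q u' v)%N -> tpos p q u v < tpos p q u' v.
Proof.
move=> h1 h2 h3.
have [npq nuv nuv'] : [/\ p != q, u != v & u' != v].
  by split; apply/eqP => e; subst; move: h1 h2; rewrite /around ?co0; lia.
(* With v shared, u and u' lie on the same side of p, and the longer interval has the farther
   endpoint. *)
have R : [&& 0 < co q u', co q u' < co q u, co q u < co q p & co q p < co q v]%N ||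
  [&& 0 < co q v, co q v < co q p, co q p < co q u & co q u < co q u']%N.
  by move: h1 h2 h3; rewrite /around /len; lia.
have := cross_ratio_lt0 R.
have S w := @tpos_den_around p q w v.
have := S _ h2; have := S _ h1.
rewrite !tposE //.
move: (u%:R : rat) (u'%:R : rat) (v%:R : rat) (p%:R : rat) (q%:R : rat) => x x' y a b.
set M := (b - a) * (x + y - a - b); set M' := (b - a) * (x' + y - a - b).
move=> hM hM' h.
have nM : M != 0 by apply/eqP => e; move: hM; rewrite e mulr0 ltxx.
have nM' : M' != 0 by apply/eqP => e; move: hM'; rewrite e mulr0 ltxx.
have E : (x - a) * (y - a) / M - (x' - a) * (y - a) / M' =
   ((b - a) * (y - a) * (y - b) * (x - x')) / (M * M').
  rewrite -mulNr addf_div //; congr (_ / _).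
  by rewrite /M /M'; ring.
rewrite -subr_lt0 E.
(* The product of [hM] and [hM'] is this quantity times the square of y - a. *)
have hMM : 0 < (x - a) * (x' - a) * (M * M').
  have e : 0 < (y - a) ^+ 2 * ((x - a) * (x' - a) * (M * M')).
    by rewrite [ltRHS](_ : _ = (x - a) * (y - a) * M * ((x' - a) * (y - a) * M'));
       [exact: mulr_gt0 | ring].
  rewrite -(@pmulr_rgt0 _ ((y - a) ^+ 2)) // lt_def sqr_ge0 andbT.
  by apply/eqP => e0; move: e; rewrite e0 mul0r ltxx.
rewrite -(pmulr_rlt0 _ hMM).
set T := (b - a) * (y - a) * (y - b) * (x - x').
rewrite [ltLHS](_ : _ = T * (x - a) * (x' - a) * ((M * M') / (M * M'))); last by ring.
by rewrite divff ?mulr1 // mulf_neq0.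
Qed.

Lemma around_neq b a u v : around b a u v -> u != v.
Proof. by move=> h; apply/eqP => e; subst; move: h; rewrite /around; lia. Qed.

Lemma aroundC b a u v : around b a u v = around b a v u.
Proof. by rewrite /around orbC. Qed.

Lemma lenC b u v : len b u v = len b v u.
Proof. by rewrite /len addnC. Qed.

(** Both intervals contain the coordinate of p; if they were not nested, their endpoints would
    alternate and the diagonals would cross. *)
Lemma around_nested p q u v u' v' :
  around q p u v -> around q p u' v' -> ~~ cross [set u; v] [set u'; v'] ->
  (len q u v <= len q u' v')%N ->
  (minn (co q u') (co q v') <= minn (co q u) (co q v) /\
   maxn (co q u) (co q v) <= maxn (co q u') (co q v'))%N.
Proof.
wlog : u v / (co q u < co q v)%N.
  move=> W h; case/orP: (h) => /and3P[_ h1 h2] h' nc hl.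
    by apply: W => //; apply: ltn_trans h2.
  rewrite [minn (co q u) _]minnC [maxn (co q u) _]maxnC.
  apply: W => //; first exact: ltn_trans h2.
  - by rewrite aroundC.
  - by rewrite [[set v; u]]setUC.
  - by rewrite [len q v _]lenC.
wlog : u' v' / (co q u' < co q v')%N.
  move=> W l h h'; case/orP: (h') => /and3P[_ h1 h2] nc hl.
    by apply: W => //; apply: ltn_trans h2.
  rewrite [minn (co q u') _]minnC [maxn (co q u') _]maxnC.
  apply: W => //; first exact: ltn_trans h2.
  - by rewrite aroundC.
  - by rewrite [[set v'; u']]setUC.
  - by rewrite [len q v' _]lenC.
move=> l' l h1 h2 nc hl.
have c1 : ~~ [&& co q u < co q u', co q u' < co q v & co q v < co q v']%N.
  by apply: contra nc => /and3P[]; apply: cross_lt.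
have c2 : ~~ [&& co q u' < co q u, co q u < co q v' & co q v' < co q v]%N.
  by apply: contra nc => /and3P[]; rewrite crossC; apply: cross_lt.
by move: h1 h2 hl c1 c2; rewrite /around /len; lia.
Qed.

(** The passage goes through {u', v}, moving one endpoint outwards at a time, so that [tpos_mono]
    applies to each move. *)
Lemma tpos_lt p q u v u' v' :
  around q p u v -> around q p u' v' -> ~~ cross [set u; v] [set u'; v'] ->
  (len q u v < len q u' v')%N -> tpos p q u v < tpos p q u' v'.
Proof.
move=> h1 h2 nc h3.
have npq : p != q.
  by apply/eqP => e; subst; move: h1; rewrite /around ?co0; lia.
(* Exchanging u' and v' puts u and u' on the same side of p. *)
wlog h4 : u' v' h2 nc h3 / ((co q u < co q p) = (co q u' < co q p))%N.
  have [e W|e W] := eqVneq (co q u < co q p)%N (co q u' < co q p)%N; first exact: W.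
  rewrite (tpos_sym (around_neq h2)) //; apply: W.
  - by rewrite aroundC.
  - by rewrite [[set v'; u']]setUC.
  - by rewrite [len q v' _]lenC.
  by move: h1 h2 e; rewrite /around; lia.
have := around_nested h1 h2 nc (ltnW h3) => h5.
have hm : around q p u' v by move: h1 h2 h4; rewrite /around; lia.
have M1 : u = u' \/ tpos p q u v < tpos p q u' v.
  case: (eqVneq u u') => [->|ne]; [by left | right; apply: tpos_mono => //].
  have : co q u != co q u' by rewrite (inj_eq (@co_inj q)).
  by move: h1 h2 h4 h5; rewrite /len /around; lia.
have M2 : v = v' \/ tpos p q u' v < tpos p q u' v'.
  case: (eqVneq v v') => [->|ne]; [by left | right].
  rewrite tpos_sym ?(around_neq hm) // [tpos _ _ u' v']tpos_sym ?(around_neq h2) //.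
  apply: tpos_mono; [by rewrite aroundC | by rewrite aroundC |].
  have : co q v != co q v' by rewrite (inj_eq (@co_inj q)).
  by move: h1 h2 h4 h5; rewrite /len /around; lia.
case: M1 => [e1|l1]; case: M2 => [e2|l2]; subst => //.
  by rewrite ltnn in h3.
exact: lt_trans l2.
Qed.

End Coordinates.

(** * Semifields *)

Section SemifieldTheory.
Variable K : semifield.
Implicit Types x y z : K.
Local Notation "x +' y" := (sf_add x y) (at level 50, left associativity).
Local Notation "x *' y" := (sf_mul x y) (at level 40, left associativity).

Lemma sf_mulr1 x : x *' sf_one K = x.
Proof. by rewrite sf_mulC sf_mul1. Qed.

Lemma sf_mulDr x y z : x *' (y +' z) = x *' y +' x *' z.
Proof. by rewrite sf_mulC sf_mulDl !(sf_mulC x). Qed.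

Lemma sf_mulVr x : x *' sf_inv x = sf_one K.
Proof. by rewrite sf_mulC sf_mulV. Qed.

Lemma sf_mulK x y : x *' y *' sf_inv y = x.
Proof. by rewrite -sf_mulA sf_mulVr sf_mulr1. Qed.

Lemma sf_mulVK x y : x *' sf_inv y *' y = x.
Proof. by rewrite -sf_mulA sf_mulV sf_mulr1. Qed.

Lemma sf_mulIr z x y : x *' z = y *' z -> x = y.
Proof. by move=> e; rewrite -(sf_mulK x z) e sf_mulK. Qed.

Lemma sf_mulAC x y z : x *' y *' z = x *' z *' y.
Proof. by rewrite -!sf_mulA (sf_mulC y). Qed.

Lemma sf_mulACA x y z t : (x *' y) *' (z *' t) = (x *' z) *' (y *' t).
Proof. by rewrite !sf_mulA (sf_mulAC x). Qed.

Lemma sf_addACA x y z t : (x +' y) +' (z +' t) = (x +' z) +' (y +' t).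
Proof. by rewrite !sf_addA -(sf_addA x y) (sf_addC y) sf_addA. Qed.

Lemma sf_invM x y : sf_inv (x *' y) = sf_inv x *' sf_inv y.
Proof.
apply: (@sf_mulIr (x *' y)); rewrite sf_mulV (sf_mulC x) sf_mulA sf_mulVK.
by rewrite sf_mulV.
Qed.

Lemma sf_inv1 : sf_inv (sf_one K) = sf_one K.
Proof. by rewrite -[LHS]sf_mulr1 sf_mulV. Qed.

(** [None] serves as an adjoined zero, which makes the addition a commutative monoid and gives
    access to big operators. *)
Lemma sf_sum_bigop (T : Type) (w : T -> K) (s : seq T) :
  sf_sum (map w s) =
  \big[oAC (@sf_addA K) (@sf_addC K) / None]_(p <- s) Some (w p).
Proof.
case: s => [|x s]; first by rewrite big_nil.
rewrite big_cons /=; elim: s => [|y s IH]; first by rewrite big_nil.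
by rewrite big_cons Monoid.mulmCA /= -IH.
Qed.

Lemma sf_sum_cat (s t : seq K) x y :
  sf_sum s = Some x -> sf_sum t = Some y -> sf_sum (s ++ t) = Some (x +' y).
Proof.
have e u : sf_sum u = \big[oAC (@sf_addA K) (@sf_addC K) / None]_(z <- u) Some z.
  by rewrite -sf_sum_bigop map_id.
by rewrite !e big_cat /= => -> ->.
Qed.

Lemma sf_sum_mulr (s : seq K) x y : sf_sum s = Some x ->
  sf_sum [seq z *' y | z <- s] = Some (x *' y).
Proof.
case: s => [//|z s] [<-] /=; congr Some.
by elim: s => //= t s ->; rewrite sf_mulDl.
Qed.

Lemma sf_sum_perm (T : eqType) (w : T -> K) (s t : seq T) : perm_eq s t ->
  sf_sum (map w s) = sf_sum (map w t).
Proof. by move=> h; rewrite !sf_sum_bigop; apply: perm_big. Qed.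

(** Each variable stands for the value of f on the diagonal it names. Both sides expand to the same
    four terms, without subtraction. *)
Lemma exchange_generic (ag ae bg be cd gc gd ec ed ac ad bc bd ge : K) :
  bg *' cd = gc *' bd +' gd *' bc -> be *' cd = ec *' bd +' ed *' bc ->
  ac *' ge = ag *' ec +' ae *' gc -> ad *' ge = ag *' ed +' ae *' gd ->
  (ag *' be +' ae *' bg) *' cd = (ac *' bd +' ad *' bc) *' ge.
Proof.
move=> h1 h2 h3 h4; rewrite !sf_mulDl.
rewrite -!sf_mulA h1 h2 (sf_mulC bd) (sf_mulC bc) !sf_mulA h3 h4.
by rewrite !sf_mulDl !sf_mulDr !sf_mulA sf_addACA.
Qed.

(** The case c = g, where {c, d} and {g, e} share a vertex and only two of the four relations
    remain. *)
Lemma exchange_degenerate (ag ae bg be gd ed ad bd ge : K) :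
  be *' gd = ge *' bd +' ed *' bg -> ad *' ge = ag *' ed +' ae *' gd ->
  (ag *' be +' ae *' bg) *' gd = (ag *' bd +' ad *' bg) *' ge.
Proof.
move=> h1 h2; rewrite !sf_mulDl -!sf_mulA h1 (sf_mulC bg ge) !(sf_mulA ad) h2.
by rewrite sf_mulDr sf_mulDl !sf_mulA (sf_mulAC ag) -sf_addA (sf_mulAC ae).
Qed.

End SemifieldTheory.

(** * T-paths *)

Section Paths.
Variable n : nat.
Implicit Types (a b c d u v x y : 'I_n) (p r s : seq 'I_n).

(** Shifting indices by one exchanges the parities; this yields recursive equations for [odd_steps]
    and [even_steps]. *)
Lemma filter_odd_iota (T : Type) (t : seq T) i :
  [seq z.2 | z <- zip (iota i.+1 (size t)) t & odd z.1] =
    [seq z.2 | z <- zip (iota i (size t)) t & ~~ odd z.1] /\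
  [seq z.2 | z <- zip (iota i.+1 (size t)) t & ~~ odd z.1] =
    [seq z.2 | z <- zip (iota i (size t)) t & odd z.1].
Proof.
elim: t i => [|z t IH] i //=.
have [h1 h2] := IH i.+1.
by case: (odd i) => /=; rewrite -?h1 -?h2.
Qed.

Lemma even_steps_cons a b p : even_steps (a :: b :: p) = odd_steps (b :: p).
Proof. by rewrite /even_steps /odd_steps /= (filter_odd_iota _ 0).1. Qed.

Lemma odd_steps_cons a b p :
  odd_steps (a :: b :: p) = (a, b) :: even_steps (b :: p).
Proof. by rewrite /even_steps /odd_steps /= (filter_odd_iota _ 0).2. Qed.

Lemma mem_step_l z p : z \in steps p -> z.1 \in p /\ z.2 \in behead p.
Proof.
elim: p => [|a [|b p] IH] //.
rewrite [steps (a :: _)]/= in_cons => /orP[/eqP->|/IH [h1 h2]].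
  by rewrite !inE !eqxx.
by rewrite in_cons h1 orbT; split=> //; apply: mem_behead.
Qed.

(** After the first vertex, the vertices pair off as ends of even steps, with at most the last one
    left over; hence the induction by two. *)
Lemma behead_last_or_even a p v : v \in p ->
  v = last a p \/
  exists2 z, z \in even_steps (a :: p) & (v = z.1 \/ v = z.2).
Proof.
have [k] := ubnP (size p); elim: k a p => // k IH a [|x [|y p]] //= hk.
  by rewrite inE => /eqP; left.
rewrite even_steps_cons odd_steps_cons !inE => /or3P[/eqP->|/eqP->|h].
- by right; exists (x, y); rewrite ?mem_head //; left.
- by right; exists (x, y); rewrite ?mem_head //; right.
have [||e|[z hz e]] := IH y p; [lia | exact: h | by left |].
by right; exists z => //; rewrite inE hz orbT.
Qed.

Lemma steps_cons a b p : steps (a :: b :: p) = (a, b) :: steps (b :: p).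
Proof. by []. Qed.

Definition edge (z : 'I_n * 'I_n) := [set z.1; z.2].

Variable D : {set {set 'I_n}}.
Hypothesis hD : dissection D.

Definition compatible (X : {set 'I_n}) := [forall Y in D, ~~ cross X Y].

Lemma dissection_cross a b c d :
  [set a; b] \in D -> [set c; d] \in D -> cross [set a; b] [set c; d] = false.
Proof. by move=> h1 h2; apply/negbTE/(hD.2 _ _ h1 h2). Qed.

Lemma dissectionP X : X \in D -> exists a b, X = [set a; b].
Proof. by move/(hD.1) => /andP[/cards2P[a [b [_ ->]]] _]; exists a, b. Qed.

Lemma dissection_compatible X : X \in D -> compatible X.
Proof. by move=> h; apply/forall_inP => Y hY; apply: hD.2. Qed.

(** [is_Tpath] with the first vertex split off, crossings expressed by [around], and interval
    lengths in place of rational positions. *)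
Definition Tpath_spec a b p := [/\ last a p = b, a != b,
  all (fun z => (z.1 != z.2) && compatible (edge z)) (steps (a :: p)),
  uniq (map edge (steps (a :: p))) &
  all (fun z => (edge z \in D) && around b a z.1 z.2) (even_steps (a :: p)) &&
  sorted (fun z w => len b z.1 z.2 < len b w.1 w.2) (even_steps (a :: p))].

(** By [tpos_lt] the two comparisons agree for different lengths; equal lengths force mutual
    nesting, hence the same diagonal and the same position. *)
Lemma sorted_tpos a b (t : seq ('I_n * 'I_n)) :
  all (fun z => (edge z \in D) && around b a z.1 z.2) t ->
  sorted (fun x y : rat => (x < y)%R) [seq tpos a b z.1 z.2 | z <- t] =
  sorted (fun z w => len b z.1 z.2 < len b w.1 w.2) t.
Proof.
rewrite sorted_map.
apply: eq_in_sorted => -[u v] [u' v'] /andP[/= h1 h2] /andP[/= h1' h2'].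
have nc := hD.2 _ _ h1 h1'; have nc' := hD.2 _ _ h1' h1.
case: (ltngtP (len b u v) (len b u' v')) => hl.
- by rewrite (tpos_lt h2 h2').
- by apply/negbTE; rewrite -leNgt; apply/ltW/tpos_lt.
apply/negbTE.
have [m1 m2] := around_nested h2 h2' nc (eq_leq hl).
have [m3 m4] := around_nested h2' h2 nc' (eq_leq (esym hl)).
have npq : a != b.
  by apply/eqP => e; subst; move: h2; rewrite /around ?co0; lia.
suff : (u = u' /\ v = v') \/ (u = v' /\ v = u').
  case=> -[e1 e2]; subst u v; first by rewrite ltxx.
  by rewrite tpos_sym ?ltxx //; apply: around_neq h2.
have : (co b u = co b u' /\ co b v = co b v') \/ (co b u = co b v' /\ co b v = co b u').
  by clear -m1 m2 m3 m4; lia.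
by case=> -[/co_inj-> /co_inj->]; tauto.
Qed.

Lemma TpathP a b p : reflect (Tpath_spec a b p) (is_Tpath D a b (a :: p)).
Proof.
rewrite /is_Tpath /= eqxx /=.
have e z : cross [set z.1; z.2] [set a; b] = around b a z.1 z.2 := cross_around a b _ _.
under [all _ (even_steps _)]eq_all => z do rewrite e.
apply: (iffP idP).
  case/and5P => _ /eqP h1 h2 h3 /and4P[h4 h5 h6 h7].
  split => //; last by rewrite h6 -(sorted_tpos h6).
  by rewrite all_predI h3; exact: h5.
case=> h1 h2 + h4 /andP[h6 h7]; rewrite all_predI => /andP[h3 h5].
rewrite h1 h2 h3 h4 h5 h6 (sorted_tpos h6) h7 eqxx !andbT.
by case: (p) h1 h2 => //= ->; rewrite eqxx.
Qed.

Lemma dissection_lt b u v w z : [set u; v] \in D -> [set w; z] \in D ->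
  ~~ [&& co b u < co b w, co b w < co b v & co b v < co b z].
Proof.
move=> h1 h2; apply/negP => /and3P[l1 l2 l3].
by have := cross_lt l1 l2 l3; rewrite (dissection_cross h1 h2).
Qed.

(** Least length means nearest to a along the segment, by [tpos_lt]. *)
Definition first_crossing a b g d := [/\ [set g; d] \in D, around b a g d &
  forall u v, [set u; v] \in D -> around b a u v -> len b g d <= len b u v].

Lemma first_crossingC a b g d : first_crossing a b g d -> first_crossing a b d g.
Proof.
by case=> h1 h2 h3; split; rewrite 1?setUC 1?aroundC // => u v; rewrite lenC; apply: h3.
Qed.

(* Since {u, v} separates g from b without crossing {g, d}, its interval contains
   the one of {g, d}. *)
Lemma around_extend a b g d u v : [set g; d] \in D -> around b a g d ->
  [set u; v] \in D -> around b g u v -> around b a u v /\ len b g d < len b u v.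
Proof.
move=> h1 h2 h3; move: (h2); rewrite /around /len.
have dg : [set d; g] \in D by rewrite setUC.
have vu : [set v; u] \in D by rewrite setUC.
have := dissection_lt b h3 h1; have := dissection_lt b vu h1.
have := dissection_lt b dg h3; have := dissection_lt b dg vu.
by move: (co b u) (co b v) (co b a) (co b g) (co b d); lia.
Qed.

(** * T-paths and the first crossed diagonal *)

Section FirstCrossing.
Variables a b g d : 'I_n.
Hypothesis hgd : first_crossing a b g d.

Let gdD : [set g; d] \in D. Proof. by case: hgd. Qed.
Let gdA : around b a g d. Proof. by case: hgd. Qed.

Lemma first_crossing_neq : [/\ a != b, g != b, d != b, a != g & a != d] /\ g != d.
Proof.
by split; [split|]; apply/eqP => e; subst; move: gdA; rewrite /around ?co0; lia.
Qed.

Lemma first_crossing_nested u v : [set u; v] \in D -> around b a u v ->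
  minn (co b u) (co b v) <= minn (co b g) (co b d) /\
  maxn (co b g) (co b d) <= maxn (co b u) (co b v).
Proof.
move=> h1 h2; apply: (around_nested gdA h2).
  by rewrite (dissection_cross gdD h1).
by case: hgd => _ _; apply.
Qed.

Lemma around_first u v : [set u; v] \in D -> around b a u v ->
  g != u -> g != v -> around b g u v.
Proof.
move=> h1 h2; rewrite -!(inj_eq (@co_inj _ b)).
by have := first_crossing_nested h1 h2; move: h2 gdA; rewrite /around; lia.
Qed.

(** Only the first entry needs checking: the later intervals contain the first one, and g lies
    strictly inside that unless it is an endpoint. *)
Lemma all_around_first (t : seq ('I_n * 'I_n)) :
  all (fun z => (edge z \in D) && around b a z.1 z.2) t ->
  sorted (fun z w => len b z.1 z.2 < len b w.1 w.2) t ->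
  (forall z, ohead t = Some z -> g != z.1 /\ g != z.2) ->
  all (fun z => (edge z \in D) && around b g z.1 z.2) t.
Proof.
case: t => [//|z t] /andP[/andP[z1 z2] ht] /= hs hz.
have [gz1 gz2] := hz _ erefl.
have zg := around_first z1 z2 gz1 gz2.
rewrite zg z1 /=; apply/allP => w hw.
have /andP[w1 w2] := allP ht _ hw.
have hl : len b z.1 z.2 < len b w.1 w.2.
  by apply: (allP (order_path_min _ hs) _ hw) => x y u; apply: ltn_trans.
rewrite w1 /=.
have nc := hD.2 _ _ z1 w1.
have [m1 m2] := around_nested z2 w2 nc (ltnW hl).
clear -zg w2 m1 m2; rewrite /around.
by case/orP: zg => /and3P[? ? ?]; case/orP: w2 => /and3P[? ? ?]; lia.
Qed.

Lemma all_around_extend (t : seq ('I_n * 'I_n)) :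
  all (fun z => (edge z \in D) && around b g z.1 z.2) t ->
  all (fun z => (edge z \in D) && around b a z.1 z.2) t.
Proof.
apply: sub_all => z /andP[z1 z2]; rewrite z1 /=.
by have [] := around_extend gdD gdA z1 z2.
Qed.

(** A diagonal of D crossing {a, d} does not cross {g, d}, which separates a from b, so it also
    crosses {a, b}. Its interval then contains both a and d, so it cannot separate them. *)
Lemma compatible_first : compatible [set a; d].
Proof.
apply/forall_inP => X XD; have [u [v e]] := dissectionP XD; subst X.
apply/negP => h.
(* Taking d as base vertex turns crossing {a, d} into an interval condition. *)
have hA : around b a u v.
  have h1 : around d g a b by rewrite -cross_around crossC cross_around.
  have h2 : around d a u v by rewrite -cross_around crossC.
  have h3 : ~~ around d g u v by rewrite -cross_around (dissection_cross XD gdD).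
  rewrite -cross_around (cross_cycn d) /cycn; clear -h1 h2 h3.
  move: h3; rewrite /around.
  by case/orP: h1 => /and3P[? ? ?]; case/orP: h2 => /and3P[? ? ?]; lia.
have [m1 m2] := first_crossing_nested XD hA.
move: gdA h; rewrite (cross_cycn b) /cycn /around; clear -m1 m2.
case/orP => /and3P[? ? ?] /orP[]/or4P[]/and3P[? ? ?]; lia.
Qed.

(** Each such vertex is b or an endpoint of an interval having g, and hence a, strictly inside. *)
Lemma Tpath_mem_neq r v :
  all (fun z => (edge z \in D) && around b g z.1 z.2) (even_steps (g :: r)) ->
  last g r = b -> v \in r -> g != v /\ a != v.
Proof.
move=> hE hl hv; have [[ab gb db ag ad] gd] := first_crossing_neq.
have [->|[z /(allP hE)/andP[z1 z2] hz]] := behead_last_or_even g hv.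
  by rewrite hl gb ab.
have [z3 _] := around_extend gdD gdA z1 z2.
by case: hz => ->; split; apply/eqP => e; move: z2 z3;
   rewrite -e /around; clear; lia.
Qed.

Lemma edge_notin_steps x y p : x \notin p -> [set x; y] \notin map edge (steps p).
Proof.
move=> h; apply/mapP => -[z /mem_step_l [h1 h2] e].
have : x \in [set z.1; z.2] by rewrite -[[set z.1; _]]e !inE eqxx.
by rewrite !inE => /orP[]/eqP e'; move: h; rewrite e' ?h1 // (mem_behead h2).
Qed.

(** Prepending two vertices keeps parities and adds the even step {d, g}, the shortest one. The
    condition on [ohead] prevents {g, d} from occurring twice. *)
Lemma Tpath_first_long r :
  Tpath_spec a b [:: d, g & r] <-> Tpath_spec g b r /\ ohead r <> Some d.
Proof.
have [[ab gb db ag ad] gd] := first_crossing_neq.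
rewrite /Tpath_spec !steps_cons even_steps_cons odd_steps_cons.
split.
  case=> h1 _ /and3P[_ _ h2] /and3P[_ h3 h4] /andP[/andP[_ h5] h6].
  split; last first.
    case: r h3 {h1 h2 h4 h5 h6} => [//|x r]; rewrite steps_cons /= in_cons => h3 [e].
    by move: h3; rewrite e /edge /= setUC eqxx.
  have h7 := path_sorted h6.
  split=> //; apply/andP; split=> //; apply: all_around_first => // z.
  (* For the first even step (x, y), g differs from x as consecutive vertices differ, and from y as
     {g, x} and {x, y} differ. *)
  case: r h2 h4 {h1 h3 h5 h6 h7} => [//|x [//|y r]].
  rewrite !steps_cons even_steps_cons odd_steps_cons => h2 h4 [<-] /=.
  case/andP: h2 => /andP[/= -> _] _; split=> //.
  case/andP: h4; rewrite /= in_cons negb_or => /andP[h4 _] _.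
  by apply: contraNneq h4 => <-; rewrite /edge /= setUC.
case=> -[h1 _ h2 h3 /andP[h4 h5]] h6.
have M v := Tpath_mem_neq h4 h1 (v := v).
split=> //.
- by rewrite /= ad compatible_first [d == g]eq_sym gd h2 [edge (d, g)]setUC
    dissection_compatible.
- rewrite /=; apply/and3P; split=> //.
    have := @edge_notin_steps a d [:: d, g & r].
    rewrite steps_cons; apply; rewrite !inE !negb_or ad ag /=.
    by apply/negP => /M[_]; rewrite eqxx.
  (* {d, g} differs from {g, x} since x is not d, and from all later steps since these avoid g. *)
  case: r h1 h2 h3 h4 h5 h6 M => [//|x r] h1 h2 h3 h4 h5 h6 M.
  rewrite steps_cons /= in_cons negb_or; apply/andP; split.
    apply/eqP => /set2_eq[[/= e _]|[/= e _]].
      by move: gd; rewrite e eqxx.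
    by case: h6; rewrite e.
  rewrite [edge (d, g)]setUC; apply: edge_notin_steps.
  by apply/negP => /M[]; rewrite eqxx.
rewrite /= [around b a d g]aroundC gdA [edge (d, g)]setUC gdD (all_around_extend h4) /=.
case: (even_steps _) h4 h5 => [//|z t] /= /andP[/andP[z1 z2] _] ->.
by rewrite andbT lenC; have [] := around_extend gdD gdA z1 z2.
Qed.

(** Exchanging the initial g and a leaves the even steps alone. The condition on [ohead] excludes
    paths whose first even step is {d, g}, which arise by prepending. *)
Lemma Tpath_first_short r :
  Tpath_spec g b (d :: r) <-> Tpath_spec a b (d :: r) /\ ohead r <> Some g.
Proof.
have [[ab gb db ag ad] gd] := first_crossing_neq.
rewrite /Tpath_spec !steps_cons /=; split.
  case=> h1 _ /andP[_ h2] /andP[h3 h4] /andP[h5 h6].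
  have M v := Tpath_mem_neq h5 h1 (v := v).
  split; last first.
    case: r {h1 h2 h3 h4 h5 h6} M => [//|x r] M [e].
    by have [] := M g; rewrite ?eqxx // e !inE eqxx orbT.
  split=> //.
  - by rewrite /= ad compatible_first h2.
  - rewrite /=; apply/andP; split=> //; apply: edge_notin_steps.
    by apply/negP => /M[_]; rewrite eqxx.
  move: h5 h6; rewrite !even_steps_cons => h5 ->.
  by rewrite all_around_extend.
case=> -[h1 _ /andP[_ h2] /andP[_ h4]] /andP[h5 h6] h7.
have h8 : all (fun z => (edge z \in D) && around b g z.1 z.2) (even_steps [:: g, d & r]).
  move: h5 h6; rewrite !even_steps_cons => h5 h6; apply: all_around_first => // z.
  case: r h7 {h1 h2 h4 h5 h6} => [//|x r] h7; rewrite odd_steps_cons => -[<-] /=.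
  by split=> //; apply/eqP => e; case: h7; rewrite e.
have M v := Tpath_mem_neq h8 h1 (v := v).
split=> //.
- by rewrite /= gd h2 dissection_compatible.
- rewrite /=; apply/andP; split=> //; apply: edge_notin_steps.
  by apply/negP => /M[]; rewrite eqxx.
by rewrite h8; move: h6; rewrite !even_steps_cons.
Qed.

(** Otherwise x is b or an endpoint of an even step whose interval contains that of {g, d}; either
    way {a, x} would cross {g, d}. *)
Lemma Tpath_second x r : Tpath_spec a b (x :: r) -> x = g \/ x = d.
Proof.
rewrite /Tpath_spec !steps_cons /=.
case=> h1 _ /andP[/andP[_ /forall_inP/(_ _ gdD) h2] _] _ /andP[h3 _].
case: (eqVneq x g) => [|xg]; first by left.
case: (eqVneq x d) => [|xd]; first by right.
exfalso; move: h2; rewrite crossC.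
case: r h1 h3 => [|y r]; first by move=> /= ->; rewrite cross_around gdA.
rewrite even_steps_cons odd_steps_cons [all _ _]/= => _ /andP[/andP[h3 h4] _] /negP h.
have := first_crossing_nested h3 h4.
move: xg xd; rewrite -!(inj_eq (@co_inj _ b)) /= => xg xd hn.
(* Four arrangements: x above or below the interval, and either order of g and d. *)
have c1 := @cross_lt _ b g d a x; have c2 := @cross_lt _ b d g a x.
have c3 := @cross_lt _ b x a g d; have c4 := @cross_lt _ b x a d g.
rewrite [[set x; a]]setUC [cross [set a; x] _]crossC in c3.
rewrite [[set x; a]]setUC [cross [set a; x] _]crossC in c4.
rewrite [[set d; g]]setUC in c2 c4.
move: h4 gdA h; rewrite /around /=; clear -xg xd hn c1 c2 c3 c4; lia.
Qed.

End FirstCrossing.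

(** * Enumeration of T-paths by backward prolongation *)

Definition enumerates a b (s : seq (seq 'I_n)) :=
  uniq s /\ (forall p, (p \in s) = is_Tpath D a b p).

Lemma is_Tpath_cons2 a b p : is_Tpath D a b p -> exists x r, p = [:: a, x & r].
Proof.
by case: p => [|c [|x r]] // /and3P[_ /eqP/= -> _]; exists x, r.
Qed.

(** Replacing g avoids using {g, d} twice. The empty path is a dummy case. *)
Definition extend_path a d p := if p is g :: r then
  if ohead r == Some d then a :: r else [:: a, d & p] else p.

Section Enumeration.
Variables a b g d : 'I_n.
Hypothesis hgd : first_crossing a b g d.

Lemma extend_path_Tpath p : is_Tpath D g b p ->
  is_Tpath D a b (extend_path a d p) /\ nth a (extend_path a d p) 1 = d.
Proof.
move=> h; have [x [r e]] := is_Tpath_cons2 h; subst p.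
move/TpathP: h; rewrite /extend_path /=; case: eqP => [[->]|ne] h.
  by split=> //; apply/TpathP; have [] := (Tpath_first_short hgd r).1 h.
by split=> //; apply/TpathP; apply/(Tpath_first_long hgd); split.
Qed.

(** The third vertex tells the cases apart: it is g after prepending and never g after
    replacement. *)
Lemma extend_path_inj :
  {in [pred p | is_Tpath D g b p] &, injective (extend_path a d)}.
Proof.
have H x r : is_Tpath D g b [:: g, x & r] -> x = d -> ohead r <> Some g.
  move=> /TpathP h e; subst x; have [_] := (Tpath_first_short hgd r).1 h; exact.
move=> p q; rewrite !inE => hp hq.
have [x [r e]] := is_Tpath_cons2 hp; have [y [s e']] := is_Tpath_cons2 hq.
subst p q; rewrite /extend_path /=.
case: eqP => [[e1]|n1]; case: eqP => [[e2]|n2] => -[].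
- by move=> -> ->.
- by move=> _ e; case: (H _ _ hp e1); rewrite e.
- by move=> _ e; case: (H _ _ hq e2); rewrite -e.
by move=> -> ->.
Qed.

Lemma extend_path_surj r : is_Tpath D a b [:: a, d & r] ->
  exists2 p, is_Tpath D g b p & [:: a, d & r] = extend_path a d p.
Proof.
move/TpathP => h; have [e|/eqP ne] := eqVneq (ohead r) (Some g).
  case: r e h => [//|x r] /= [->] h.
  have [h1 h2] := (Tpath_first_long hgd r).1 h.
  by exists (g :: r); [apply/TpathP | rewrite /extend_path; case: eqP].
exists [:: g, d & r]; last by rewrite /extend_path /= eqxx.
by apply/TpathP; apply/(Tpath_first_short hgd).
Qed.

End Enumeration.

(** The second vertex, d or g, separates the two images, and [Tpath_second] shows that they exhaust
    all T-paths. *)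
Lemma enumerates_extend a b g d (s1 s2 : seq (seq 'I_n)) : first_crossing a b g d ->
  enumerates g b s1 -> enumerates d b s2 ->
  enumerates a b (map (extend_path a d) s1 ++ map (extend_path a g) s2).
Proof.
move=> hgd [u1 m1] [u2 m2]; have hdg := first_crossingC hgd.
have [_ gd] := first_crossing_neq hgd.
split.
  rewrite cat_uniq !map_inj_in_uniq ?u1 ?u2 ?andbT /=; first last.
  - by move=> p q; rewrite !m1 => h h'; apply: (extend_path_inj hgd).
  - by move=> p q; rewrite !m2 => h h'; apply: (extend_path_inj hdg).
  apply/hasPn => _ /mapP[p hp ->]; apply/mapP => -[q hq e].
  rewrite m1 in hq; rewrite m2 in hp.
  have [_ eg] := extend_path_Tpath hdg hp; have [_ ed] := extend_path_Tpath hgd hq.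
  by move: gd; rewrite -ed -e eg eqxx.
move=> p; rewrite mem_cat; apply/idP/idP.
  case/orP => /mapP[q hq ->].
    by rewrite m1 in hq; have [] := extend_path_Tpath hgd hq.
  by rewrite m2 in hq; have [] := extend_path_Tpath hdg hq.
move=> h; have [x [r e]] := is_Tpath_cons2 h; subst p.
have /TpathP h' := h; case: (Tpath_second hgd h') => e; subst x.
  have [q hq ->] := extend_path_surj hdg h.
  by rewrite (map_f _ (_ : q \in s2)) ?orbT // m2.
have [q hq ->] := extend_path_surj hgd h.
by rewrite (map_f _ (_ : q \in s1)) // m1.
Qed.

(** An even step would be a diagonal of D crossing {a, b}, so a T-path has a single step. *)
Lemma enumerates_uncrossed a b : a != b ->
  (forall X, X \in D -> ~~ cross X [set a; b]) ->
  enumerates a b [:: [:: a; b]].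
Proof.
move=> ab hX; split=> // p; rewrite inE; apply/eqP/idP.
  move=> ->; apply/TpathP; split=> //=; rewrite ab andbT /=.
  apply/forall_inP => X XD; have [u [v e]] := dissectionP XD; subst X.
  by rewrite crossC hX.
move=> h; have [x [r e]] := is_Tpath_cons2 h; subst p.
move/TpathP: h => [+ _ _ _ /andP[+ _]].
case: r => [/= -> //|y r]; rewrite even_steps_cons odd_steps_cons.
by move=> _ /andP[/andP[/hX]]; rewrite cross_around => /negbTE->.
Qed.

Definition crossing_number a b := #|[set X in D | cross X [set a; b]]|.

Lemma crossing_numberC a b : crossing_number a b = crossing_number b a.
Proof. by rewrite /crossing_number [[set a; b]]setUC. Qed.

(** What crosses {g, b} also crosses {a, b}, while {g, d} itself shares g with {g, b} and is
    lost. *)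
Lemma crossing_number_lt a b g d : [set g; d] \in D ->
  cross [set g; d] [set a; b] -> crossing_number g b < crossing_number a b.
Proof.
rewrite cross_around => h1 h2; apply: proper_card; apply/properP; split.
  apply/subsetP => X; rewrite !inE => /andP[XD].
  have [u [v e]] := dissectionP XD; subst X; rewrite XD !cross_around.
  by case/(around_extend h1 h2 XD).
exists [set g; d]; rewrite !inE h1 /= cross_around ?h2 // /around.
by clear; lia.
Qed.

Lemma first_crossing_exists a b X : X \in D -> cross X [set a; b] ->
  exists g d, first_crossing a b g d.
Proof.
move=> XD; have [u [v e]] := dissectionP XD; subst X => hX.
pose P (z : 'I_n * 'I_n) := (edge z \in D) && cross (edge z) [set a; b].
have P0 : P (u, v) by rewrite /P /edge /= XD hX.
case: (@arg_minnP _ (u, v) P (fun z => len b z.1 z.2) P0) => -[g d] /andP[h1 h2] hm.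
exists g, d; split=> //; first by rewrite -cross_around.
by move=> x y hx hy; apply: (hm (x, y)); rewrite /P /edge /= hx cross_around.
Qed.

(** * Weights of T-paths and the two implications *)

Section Weights.
Variables (K : semifield) (f : {set 'I_n} -> K).
Local Notation "x +' y" := (sf_add x y) (at level 50, left associativity).
Local Notation "x *' y" := (sf_mul x y) (at level 40, left associativity).

(** Replacement turns the odd factor f(g, d) into f(a, d); prepending adds an odd factor f(a, d) and
    an even factor f(g, d). *)
Lemma Tweight_extend_path a b g d p : is_Tpath D g b p ->
  Tweight f (extend_path a d p) =
  Tweight f p *' (f [set a; d] *' sf_inv (f [set g; d])).
Proof.
move=> h; have [x [r e]] := is_Tpath_cons2 h; subst p.
rewrite /extend_path /=; case: eqP => [[->]|_]; rewrite /Tweight;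
  rewrite !(even_steps_cons, odd_steps_cons) /=.
  set E := sf_prod _; set O := sf_inv _; set G := f [set g; d].
  rewrite sf_mulA -(sf_mulA G) -(sf_mulA G) (sf_mulC G) sf_mulK.
  by rewrite [in RHS]sf_mulC sf_mulA.
by rewrite [[set d; g]]setUC sf_invM sf_mulACA sf_mulC.
Qed.

Lemma sf_sum_extend a b g d (s1 s2 : seq (seq 'I_n)) (x1 x2 : K) :
  first_crossing a b g d ->
  enumerates g b s1 -> enumerates d b s2 ->
  sf_sum (map (Tweight f) s1) = Some x1 -> sf_sum (map (Tweight f) s2) = Some x2 ->
  sf_sum (map (Tweight f) (map (extend_path a d) s1 ++ map (extend_path a g) s2)) =
  Some ((f [set a; g] *' x2 +' f [set a; d] *' x1) *' sf_inv (f [set g; d])).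
Proof.
move=> hgd [_ m1] [_ m2] e1 e2; rewrite map_cat -!map_comp.
have -> : map (Tweight f \o extend_path a d) s1 =
    map (fun z => z *' (f [set a; d] *' sf_inv (f [set g; d]))) (map (Tweight f) s1).
  rewrite -map_comp; apply/eq_in_map => p; rewrite m1 => hp /=.
  exact: Tweight_extend_path hp.
have -> : map (Tweight f \o extend_path a g) s2 =
    map (fun z => z *' (f [set a; g] *' sf_inv (f [set g; d]))) (map (Tweight f) s2).
  rewrite -map_comp; apply/eq_in_map => p; rewrite m2 => hp /=.
  by rewrite [[set g; d]]setUC; apply: Tweight_extend_path hp.
rewrite (sf_sum_cat (sf_sum_mulr _ e1) (sf_sum_mulr _ e2)); congr Some.
by rewrite sf_addC !sf_mulA !(sf_mulC _ (f [set a; _])) -sf_mulDl.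
Qed.

Lemma weak_frieze_Tpath_formula : weak_frieze D f -> Tpath_formula D f.
Proof.
move=> hf a b; have [k] := ubnP (crossing_number a b).
elim: k a => // k IH a hk ab.
have [/existsP[X /andP[XD hX]]|/existsPn hX] :=
  boolP [exists X, (X \in D) && cross X [set a; b]]; last first.
  exists [:: [:: a; b]].
  have [X XD|u m] := enumerates_uncrossed ab.
    by have := hX X; rewrite XD.
  by split=> //=; rewrite /Tweight /= sf_inv1 !sf_mulr1.
have [g [d hgd]] := first_crossing_exists XD hX.
have [[_ gb db _ _] _] := first_crossing_neq hgd.
have [gdD gdA _] := hgd; rewrite -cross_around in gdA.
have dgD : [set d; g] \in D by rewrite setUC.
have dgA : cross [set d; g] [set a; b] by rewrite [[set d; g]]setUC.
have [|s1 [u1 m1 e1]] := IH g _ gb.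
  by have := crossing_number_lt gdD gdA; lia.
have [|s2 [u2 m2 e2]] := IH d _ db.
  by have := crossing_number_lt dgD dgA; lia.
have [u m] := enumerates_extend hgd (conj u1 m1) (conj u2 m2).
exists (map (extend_path a d) s1 ++ map (extend_path a g) s2); split=> //.
rewrite (sf_sum_extend hgd (conj u1 m1) (conj u2 m2) e1 e2); congr Some.
(* The Ptolemy relation for {g, d}, divided by f(g, d). *)
have := hf a b g d gdD; rewrite crossC gdA => /(_ isT) e.
by rewrite [[set d; b]]setUC [[set g; b]]setUC -e sf_mulK.
Qed.

(** The list given by the formula and the prolonged lists enumerate the same T-paths, so their
    weight sums agree. *)
Lemma Ptolemy_first_crossing a b g d : Tpath_formula D f ->
  first_crossing a b g d -> f [set a; b] *' f [set g; d] =
    f [set a; g] *' f [set b; d] +' f [set a; d] *' f [set b; g].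
Proof.
move=> hf hgd; have [[ab gb db _ _] _] := first_crossing_neq hgd.
have [s1 [u1 m1 e1]] := hf _ _ gb; have [s2 [u2 m2 e2]] := hf _ _ db.
have [s [u m e]] := hf _ _ ab.
have [u' m'] := enumerates_extend hgd (conj u1 m1) (conj u2 m2).
have := sf_sum_extend hgd (conj u1 m1) (conj u2 m2) e1 e2.
have hp : perm_eq s (map (extend_path a d) s1 ++ map (extend_path a g) s2).
  by apply: uniq_perm => // p; rewrite m m'.
rewrite -(sf_sum_perm _ hp) e => -[->].
by rewrite sf_mulVK [[set d; b]]setUC [[set g; b]]setUC.
Qed.

Lemma Tpath_formula_weak_frieze : Tpath_formula D f -> weak_frieze D f.
Proof.
move=> hf a b; have [k] := ubnP (crossing_number a b).
elim: k a b => // k IH a b hk c d cdD hX.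
have cdX : cross [set c; d] [set a; b] by rewrite crossC.
have [g [e hge]] := first_crossing_exists cdD cdX.
have [geD geA _] := hge; have R := Ptolemy_first_crossing hf hge.
have cdA : around b a c d by rewrite -cross_around.
(* The relation is symmetric in c and d, so c may be taken on the side of g. *)
wlog hside : c d cdD hX cdX cdA / (co b c < co b a) = (co b g < co b a).
  move=> W; have [hs|hs] := eqVneq (co b c < co b a) (co b g < co b a).
    exact: W.
  rewrite [[set c; d]]setUC [RHS]sf_addC; apply: W; rewrite 1?[[set d; c]]setUC //.
    by rewrite aroundC.
  by clear -hs geA cdA; move: hs geA cdA; rewrite /around; lia.
have [nm nM] := first_crossing_nested hge cdD cdA.
have fC x y : f [set x; y] = f [set y; x] by rewrite setUC.
have egD : [set e; g] \in D by rewrite setUC.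
have dcD : [set d; c] \in D by rewrite setUC.
have lt_a z w : [set z; w] \in D -> around b a z w -> crossing_number z b < k.
  move=> zD; rewrite -cross_around => /(crossing_number_lt zD).
  by clear -hk; lia.
have lt_b z w : [set z; w] \in D -> around b a z w -> crossing_number a z < k.
  move=> zD; rewrite crossing_numberC -cross_around [[set a; b]]setUC => h.
  have := crossing_number_lt zD h; rewrite (crossing_numberC b).
  by clear -hk; lia.
have egA : around b a e g by rewrite aroundC.
have dcA : around b a d c by rewrite aroundC.
(* If c is not g, nesting puts g strictly inside the interval of {c, d}, so {c, d} crosses {g,
   b}. *)
have Hg : c != g -> f [set b; g] *' f [set c; d] =
    f [set g; c] *' f [set b; d] +' f [set g; d] *' f [set b; c].
  rewrite -(inj_eq (@co_inj _ b)) (fC b g) => ne.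
  apply: (IH g b _ c d cdD); first exact: lt_a geA.
  rewrite crossC cross_around; clear -ne hside geA cdA nm nM.
  by move: geA cdA; rewrite /around; lia.
have He : d != e -> f [set b; e] *' f [set c; d] =
    f [set e; c] *' f [set b; d] +' f [set e; d] *' f [set b; c].
  rewrite -(inj_eq (@co_inj _ b)) (fC b e) => ne.
  apply: (IH e b _ c d cdD); first exact: lt_a egA.
  rewrite crossC cross_around; clear -ne hside geA cdA nm nM.
  by move: geA cdA; rewrite /around; lia.
(* If c is not g, it lies beyond g as seen from a, so {g, e} crosses {a, c}. *)
have Hc : c != g -> f [set a; c] *' f [set g; e] =
    f [set a; g] *' f [set e; c] +' f [set a; e] *' f [set g; c].
  rewrite -(inj_eq (@co_inj _ b)) (fC e c) (fC g c) => ne.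
  apply: (IH a c _ g e geD); first exact: lt_b cdA.
  clear -ne hside geA cdA nm nM.
  have c1 := @cross_lt _ b c a g e; have c2 := @cross_lt _ b e g a c.
  rewrite [[set c; a]]setUC in c1; rewrite crossC [[set e; g]]setUC in c2.
  by move: geA cdA; rewrite /around; lia.
have Hd : d != e -> f [set a; d] *' f [set g; e] =
    f [set a; g] *' f [set e; d] +' f [set a; e] *' f [set g; d].
  rewrite -(inj_eq (@co_inj _ b)) (fC e d) (fC g d) => ne.
  apply: (IH a d _ g e geD); first exact: lt_b dcA.
  clear -ne hside geA cdA nm nM.
  have c1 := @cross_lt _ b d a e g; have c2 := @cross_lt _ b g e a d.
  rewrite [[set d; a]]setUC [[set e; g]]setUC in c1; rewrite crossC in c2.
  by move: geA cdA; rewrite /around; lia.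
(* After multiplication by f(g, e), [R] eliminates f(a, b). *)
apply: (@sf_mulIr _ (f [set g; e])); rewrite sf_mulAC R.
have [cg|cg] := eqVneq c g; have [de|de] := eqVneq d e.
- by subst.
- subst c; apply: exchange_degenerate; last exact: Hd.
  by rewrite He // (fC e g).
(* Mirror image of the previous case, obtained by exchanging the summands. *)
- subst d; rewrite sf_addC [in RHS]sf_addC (fC c e).
  apply: exchange_degenerate.
    by rewrite (fC e c) Hg // sf_addC.
  by rewrite Hc // sf_addC.
by apply: exchange_generic (Hg cg) (He de) (Hc cg) (Hd de).
Qed.

End Weights.
End Paths.

Theorem theoremA (K : semifield) (n : nat) (hn : (3 <= n)%N)
    (D : {set {set 'I_n}}) (hD : dissection D) (f : {set 'I_n} -> K) :
  weak_frieze D f <-> Tpath_formula D f.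
Proof.
split; [exact: weak_frieze_Tpath_formula | exact: Tpath_formula_weak_frieze].
Qed.
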